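(* Fix any $\overline{\varphi}\in\overline{\Phi}$, $\vartheta\in\Theta$ and $w\in\mathrm{W}$ satisfying $M(w)=\vartheta\circ E(\overline{\varphi})$ (for example $w:=\vartheta\circ E(\overline{\varphi})$). Define $g_0\in\mathrm{G}$ by $g_0(t,x):=\vartheta(t)-w(x)$, and let $\{g_n\}_{n\in\mathbb{N}}\subset\mathrm{G}$ verify $\Vert g_0-g_n\Vert_{\mathbb{R}_+^2}\xrightarrow{n\to\infty}0$ (for example $g_n:=g_0$). Then $d_{\overline{\Phi}}(\varphi_n,\overline{\varphi})\xrightarrow{n\to\infty}0$, where each $\varphi_n$ is the global solution of the initial value problem $x'=n\,g_n(t,x)$, $x(0)=0$. Thus every $\overline{\varphi}\in\overline{\Phi}$ can be constructed as a limit, on $(\overline{\Phi},d_{\overline{\Phi}})$, of such solutions $\varphi_n$.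
   Context: $\mathbb{R}_+=[0,\infty)$. $\mathrm{G}\subset C(\mathbb{R}_+^2,\mathbb{R})$ is the set of continuous $g:\mathbb{R}_+^2\to\mathbb{R}$, $(t,x)\mapsto g(t,x)$, such that: (i) $g(0,0)\ge0$; (ii) $g(\cdot,x)$ is strictly increasing for each $x\in\mathbb{R}_+$; (iii) $\inf_{x\in\mathbb{R}_+}g(t,x)<0$ for all $t\in\mathbb{R}_+$; (iv) $\sup_{t\in\mathbb{R}_+}g(t,x)>0$ for all $x\in\mathbb{R}_+$. $\Theta$ is the set of strictly increasing $\vartheta\in C(\mathbb{R}_+,\mathbb{R})$ with $\vartheta(0)=0$ and $\lim_{t\to\infty}\vartheta(t)=\infty$. $\mathrm{W}$ is the set of $w\in C(\mathbb{R}_+,\mathbb{R})$ with $w(0)\le0$ and $\sup_{x\in\mathbb{R}_+}w(x)=\infty$. $\Phi$ is the set of bijective paths in $C^1_0(\mathbb{R}_+,\mathbb{R}_+)$ (continuously differentiable bijections of $\mathbb{R}_+$ starting from $0$). For $g\in\mathrm{G}$ the problem $x'=g(t,x)$, $x(0)=0$ has a unique global solution over $\mathbb{R}_+$, and it lies in $\Phi$. $\overline{\Phi}\supset\Phi$ is the set of strictly increasing càdlàg paths $\overline{\varphi}\in D(\mathbb{R}_+,\mathbb{R}_+)$ with $\lim_{t\to\infty}\overline{\varphi}(t)=\infty$. Exit-time functional: $E(\overline{\varphi})(x):=\inf\{t>0:\overline{\varphi}(t)>x\}$, $x\in\mathbb{R}_+$. Supremum functional: $M(w)(x):=\sup\{0\vee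 w(u):u\in[0,x]\}$. Exit-time metric on $\overline{\Phi}$: $d_{\overline{\Phi}}(\overline{\varphi}_1,\overline{\varphi}_2):=\Vert E(\overline{\varphi}_2)-E(\overline{\varphi}_1)\Vert_{\mathbb{R}_+}$. Norms: $\Vert w\Vert_{\mathbb{R}_+}:=\sum_{n\in\mathbb{N}}2^{-n}(1\wedge\sup_{t\in[0,n]}|w(t)|)$ and $\Vert g\Vert_{\mathbb{R}_+^2}:=\sum_{n\in\mathbb{N}}2^{-n}(1\wedge\sup_{[0,n]^2}|g|)$. *)

(* Defs.v *)
From HB Require Import structures.
From mathcomp Require Import all_boot all_order all_algebra.
From mathcomp Require Import all_classical all_reals all_analysis.
Set Implicit Arguments.
Unset Strict Implicit.
Unset Printing Implicit Defensive.
Import Order.TTheory GRing.Theory Num.Theory.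
Import numFieldNormedType.Exports.

Local Open Scope classical_set_scope.
Local Open Scope ring_scope.

(* Functions on R_+ = [0, +oo[ (resp. R_+^2) are total functions on R (resp.
   curried functions on R * R) of which only the restriction to R_+
   (resp. R_+^2) is ever used.  The index set of sequences and of the series
   defining the norms is {1, 2, ...}. *)

Section Defs.
Context {R : realType}.
Implicit Types (phi theta w : R -> R) (g f : R -> R -> R).

Definition Rplus : set R := `[0, +oo[.

Definition strictly_increasing phi : Prop :=
  {in `[0, +oo[ &, {homo phi : s t / s < t}}.

(* The infimum and suprema range over unbounded sets, hence the extended
   reals: the real-valued [inf] and [sup] return 0 on unbounded sets. *)
Definition classG : set (R -> R -> R) := [set g : R -> R -> R |
  [/\ {within Rplus `*` Rplus, continuous (fun p : R * R => g p.1 p.2)},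
      0 <= g 0 0,
      forall x, Rplus x -> strictly_increasing (fun t => g t x),
      forall t, Rplus t -> (ereal_inf [set (g t x)%:E | x in Rplus] < 0)%E
    & forall x, Rplus x -> (0 < ereal_sup [set (g t x)%:E | t in Rplus])%E]].

Definition classTheta : set (R -> R) := [set theta : R -> R |
  [/\ {within Rplus, continuous theta},
      strictly_increasing theta,
      theta 0 = 0
    & theta t @[t --> +oo] --> +oo]].

Definition classW : set (R -> R) := [set w : R -> R |
  [/\ {within Rplus, continuous w},
      w 0 <= 0
    & ereal_sup [set (w x)%:E | x in Rplus] = +oo%E]].

Definition cadlag phi : Prop :=
  (forall t, 0 <= t -> phi s @[s --> t^'+] --> phi t) /\
  (forall t, 0 < t -> cvg (phi s @[s --> t^'-])).

Definition Phibar : set (R -> R) := [set phi : R -> R |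
  [/\ {homo phi : t / Rplus t},
      cadlag phi,
      strictly_increasing phi
    & phi t @[t --> +oo] --> +oo]].

Definition exit_time phi (x : R) : R := inf [set t | 0 < t /\ x < phi t].

Definition run_max w (x : R) : R := sup [set Num.max 0 (w u) | u in `[0, x]].

Definition norm_Rplus w : R :=
  \big[+%R/0]_(1 <= k <oo)
    (2 ^- k * Num.min 1 (sup [set `|w t| | t in `[0, k%:R]])).

Definition norm_Rplus2 g : R :=
  \big[+%R/0]_(1 <= k <oo)
    (2 ^- k * Num.min 1
       (sup [set `|g t x| | t in `[0, k%:R] & x in `[0, k%:R]])).

Definition dist_Phibar phi1 phi2 : R :=
  norm_Rplus (fun x => exit_time phi2 x - exit_time phi1 x).

(* Convergence in the metric space (Phibar, dist_Phibar): the terms of the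
   sequence are required to be points of that space. *)
Definition cvg_Phibar (phi_ : nat -> R -> R) phi : Prop :=
  [/\ forall n, (0 < n)%N -> Phibar (phi_ n),
      Phibar phi
    & dist_Phibar (phi_ n) phi @[n --> \oo] --> (0 : R)].

(* phi is a global solution over R_+ of x' = f(t, x), x(0) = 0.  As f is only
   given on R_+^2, phi takes its values in R_+; the derivative at t is taken
   within R_+, so it is the right derivative at t = 0 and the usual derivative
   at t > 0. *)
Definition global_solution f phi : Prop :=
  [/\ phi 0 = 0,
      {homo phi : t / Rplus t}
    & forall t, Rplus t ->
        (phi s - phi t) / (s - t) @[s --> within Rplus t^'] --> f t (phi t)].

End Defs.

(* Main.v *)
Require Import Defs.
From HB Require Import structures.
From mathcomp Require Import all_boot all_order all_algebra.
From mathcomp Require Import all_classical all_reals all_analysis.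
From mathcomp Require Import lra.
Import Order.TTheory GRing.Theory Num.Theory.
Import numFieldNormedType.Exports.
Local Open Scope classical_set_scope.
Local Open Scope ring_scope.

(* Let E be the exit-time functional and T = E(phibar)(x).  If t < T then
   theta(t) < M(w)(x), so g_0(t, u) < 0 for some u <= x; hence g_n(t, u) < 0 for
   large n, and as g_n increases in time the level u is a barrier that phi_n
   cannot cross before t, so E(phi_n)(x) >= t.  If t > a > T then
   theta(a) > M(w)(x), so g_n(a, .) is bounded below by some eta > 0 on [0, x]
   for large n, and phi_n leaves [0, x] before t because its speed on [a, t] is
   at least n * eta.  So E(phi_n) tends to E(phibar) pointwise; these functions
   are nondecreasing and the limit is continuous, hence the convergence is
   locally uniform.

   Solutions for the last claim are explicit: if phi = psi^-1 with psi' > 0,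
   then phi solves x' = n * g(t, x) for g(t, x) = t - psi(x) + 1 / (n * psi'(x)).
   With psi_n a mollification of E(phibar) of slope at least n^(-1/2), these
   fields belong to G and converge to t - E(phibar)(x). *)

(** * Exit times *)

Section ExitTime.
Context {R : realType}.
Implicit Types (phi : R -> R) (x t : R).

Lemma exit_time_ge0 phi x : 0 <= exit_time phi x.
Proof.
rewrite /exit_time; set A := [set t | _].
have [ne|/nonemptyPn ->] := pselect (A !=set0); last by rewrite inf0.
by apply: lb_le_inf => // t /= [/ltW].
Qed.

Lemma exit_time_le phi x t : 0 < t -> x < phi t -> exit_time phi x <= t.
Proof. by move=> t0 xt; apply: ge_inf => //; exists 0 => s /= [/ltW]. Qed.

Lemma strictly_increasing_le phi : strictly_increasing phi ->
  forall s t, 0 <= s -> s <= t -> phi s <= phi t.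
Proof.
move=> inc s t s0; rewrite le_eqVlt => /predU1P[->//|st].
by apply/ltW/inc; rewrite // in_itv/= andbT//; lra.
Qed.

Lemma exit_time_set_neq0 phi x : Phibar phi ->
  [set t | 0 < t /\ x < phi t] !=set0.
Proof.
move=> [_ _ _ /cvgryPgt/(_ x) H].
have [t [xt t0]] := filter_ex (filterI H (nbhs_pinfty_gt (@num_real R 0))).
by exists t.
Qed.

Lemma le_exit_time phi x t : Phibar phi -> phi t <= x ->
  t <= exit_time phi x.
Proof.
move=> Pphi xt; apply: lb_le_inf; first exact: exit_time_set_neq0.
move=> s /= [s0 xs]; rewrite leNgt; apply/negP => st.
have inc : strictly_increasing phi by case: Pphi.
by have := strictly_increasing_le _ inc s t (ltW s0) (ltW st); lra.
Qed.

Lemma exit_time_lt phi x t : Phibar phi -> exit_time phi x < t -> x < phi t.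
Proof.
by move=> Pphi; rewrite !ltNge; apply: contraNN; exact: le_exit_time.
Qed.

Lemma lt_exit_time phi x t : 0 < t -> t < exit_time phi x -> phi t <= x.
Proof.
move=> t0; rewrite ltNge [phi t <= x]leNgt; apply: contraNN.
exact: exit_time_le.
Qed.

Lemma exit_time_homo phi : Phibar phi -> {homo exit_time phi : x y / x <= y}.
Proof.
move=> Pphi x y xy; apply: lb_le_inf; first exact: exit_time_set_neq0.
by move=> t /= [t0 yt]; apply: exit_time_le => //; apply: le_lt_trans yt.
Qed.

Lemma exit_time_le0 phi x : Phibar phi -> x <= 0 -> exit_time phi x = 0.
Proof.
move=> Pphi x0; apply/eqP; rewrite eq_le exit_time_ge0 andbT.
apply/ler_addgt0Pl => e e0; rewrite addr0; apply: exit_time_le => //.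
case: Pphi => pos _ inc _; apply: (le_lt_trans x0).
apply: (@le_lt_trans _ _ (phi 0)).
  by have := pos 0; rewrite /Rplus /= !in_itv/= !andbT; apply.
by apply: inc; rewrite ?in_itv/= ?lexx// ltW.
Qed.

(** Just after the exit time [phi] exceeds [x], hence also all levels slightly above [x]. A jump
    from below would make [phi] constant on a time interval, against strict monotonicity. *)
Lemma exit_time_continuous phi : Phibar phi -> continuous (exit_time phi).
Proof.
move=> Pphi x; apply/cvgrPdist_le => e e0.
have inc : strictly_increasing phi by case: Pphi.
have T0 := exit_time_ge0 phi x.
have up : x < phi (exit_time phi x + e).
  by apply: exit_time_lt => //; rewrite ltrDl.
have lo : \forall y \near x, exit_time phi x - e <= exit_time phi y.
  have [Te|Te] := ltP (exit_time phi x - e) 0.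
    by near=> y; apply: (le_trans (ltW Te)); exact: exit_time_ge0.
  (* The intermediate time [exit_time phi x - e / 2] turns the weak bound available before the exit
     into a strict one. *)
  have lx : phi (exit_time phi x - e) < x.
    apply: (@lt_le_trans _ _ (phi (exit_time phi x - e / 2))).
      by apply: inc; rewrite ?in_itv/= ?andbT//; lra.
    by apply: lt_exit_time; lra.
  near=> y; apply: le_exit_time => //; apply: ltW.
  by near: y; exact: lt_nbhsr.
near=> y; rewrite ler_distlC; apply/andP; split.
  by near: y.
apply: exit_time_le; first lra.
by near: y; exact: lt_nbhsl.
Unshelve. all: by end_near. Qed.

Lemma exit_time_unbounded phi : Phibar phi ->
  forall t, exists2 x, 0 <= x & t <= exit_time phi x.
Proof.
move=> Pphi t; exists (phi (Num.max 0 t)).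
  case: Pphi => pos _ _ _; have := pos (Num.max 0 t).
  by rewrite /Rplus /= !in_itv/= !andbT; apply; rewrite le_max lexx.
apply: (@le_trans _ _ (Num.max 0 t)); first by rewrite le_max lexx orbT.
exact: le_exit_time.
Qed.

End ExitTime.

(** * The weighted norms *)

Section WeightedSeries.
Context {R : realType}.
Implicit Types a : nat -> R.

Let S a m : R := \sum_(1 <= k < m) (2 ^- k * a k).

(** Terms up to [K] are charged to [eps] times a geometric sum, later ones to the bare geometric
    tail. Keeping both sums in closed form lets the induction on [m] close. *)
Lemma weighted_sum_le a (eps : R) (K : nat) : 0 <= eps ->
    (forall k, 0 <= a k <= 1) ->
    (forall k, (0 < k <= K)%N -> a k <= eps) ->
  forall m, \sum_(1 <= k < m.+1) (2 ^- k * a k) <=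
    eps * (1 - 2 ^- m) + (if (m <= K)%N then 0 else 2 ^- K - 2 ^- m).
Proof.
move=> eps0 a01 aK; elim=> [|m IH].
  by rewrite big_geq// leq0n expr0 invr1 subrr mulr0 addr0.
rewrite big_nat_recr//=.
have p0 : 0 < 2 ^- m :> R by rewrite invr_gt0 exprn_gt0.
have pS : 2 ^- m = 2 * 2 ^- m.+1 :> R.
  by rewrite exprS invfM mulrA mulfV ?mul1r.
have q0 : 0 < 2 ^- m.+1 :> R by rewrite invr_gt0 exprn_gt0.
have /andP[a0 a1] := a01 m.+1.
case: ifPn => [mK|mK].
  have := aK m.+1; rewrite mK => /(_ isT) ae.
  move: IH; rewrite (ltnW mK); move: pS ae q0 => ->.
  move: (2 ^- m.+1) (a m.+1) => q b; nra.
have q1 : 2 ^- m.+1 * a m.+1 <= 2 ^- m.+1 by nra.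
have eq0 : 0 <= eps * 2 ^- m.+1 by apply: mulr_ge0 => //; exact: ltW.
(* Passing the cut-off: here [K = m], and the tail consists of the single weight [2 ^- m.+1]. *)
case: ifPn IH => [mK'|mK'] IH.
  have -> : K = m by apply/eqP; rewrite eqn_leq mK' andbT leqNgt.
  move: IH q1 eq0; rewrite pS; move: (2 ^- m.+1) => q; lra.
by move: IH q1 eq0; rewrite pS; move: (2 ^- m.+1) (2 ^- K) => q r; lra.
Qed.

Lemma weighted_sum_nd a : (forall k, 0 <= a k) ->
  nondecreasing_seq (S a).
Proof.
move=> a0; apply/nondecreasing_seqP => -[|m]; first by rewrite /S !big_geq.
by rewrite /S [leRHS]big_nat_recr//= lerDl mulr_ge0// invr_ge0 exprn_ge0.
Qed.

Lemma weighted_sum_cvg a : (forall k, 0 <= a k <= 1) -> cvgn (S a).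
Proof.
move=> a01; apply: nondecreasing_is_cvgn.
  by apply: weighted_sum_nd => k; case/andP: (a01 k).
exists 1 => _ [m _ <-]; case: m => [|m]; first by rewrite /S big_geq.
(* With [eps = 1] and [K = m] the tail is empty and the bound is [1 - 2 ^- m]. *)
apply: (le_trans (@weighted_sum_le a 1 m ler01 a01 _ m)).
  by move=> k _; case/andP: (a01 k).
by rewrite leqnn mul1r addr0 gerBl invr_ge0 exprn_ge0.
Qed.

Lemma weighted_series_ge a k : (forall k, 0 <= a k <= 1) -> (0 < k)%N ->
  2 ^- k * a k <= \big[+%R/0]_(1 <= j <oo) (2 ^- j * a j).
Proof.
move=> a01 k0.
apply: (@le_trans _ _ (S a k.+1)).
  rewrite /S big_nat_recr//= lerDr sumr_ge0// => j _.
  by rewrite mulr_ge0 ?invr_ge0 ?exprn_ge0//; case/andP: (a01 j).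
apply: nondecreasing_cvgn_le; last exact: weighted_sum_cvg.
by apply: weighted_sum_nd => j; case/andP: (a01 j).
Qed.

Lemma weighted_series_bound a (eps : R) (K : nat) : 0 <= eps ->
    (forall k, 0 <= a k <= 1) ->
    (forall k, (0 < k <= K)%N -> a k <= eps) ->
  0 <= \big[+%R/0]_(1 <= j <oo) (2 ^- j * a j) <= eps + 2 ^- K.
Proof.
move=> eps0 a01 aK; have cS := weighted_sum_cvg a a01.
apply/andP; split.
  apply: limr_ge => //; apply: nearW => m.
  rewrite sumr_ge0// => j _.
  by rewrite mulr_ge0 ?invr_ge0 ?exprn_ge0//; case/andP: (a01 j).
apply: limr_le => //; apply: nearW => -[|m].
  by rewrite big_geq// addr_ge0// invr_ge0 exprn_ge0.
apply: (le_trans (weighted_sum_le _ _ _ eps0 a01 aK m)).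
have p0 : 0 <= 2 ^- m :> R by rewrite invr_ge0 exprn_ge0.
have K0 : 0 <= 2 ^- K :> R by rewrite invr_ge0 exprn_ge0.
case: ifP => _; move: (2 ^- m) (2 ^- K) p0 K0 => p q; nra.
Qed.

(** Dominated convergence for the weights: [K] makes the tail at most [e / 2] uniformly in [n], then
    the finitely many remaining terms are made small. *)
Lemma weighted_series_cvg0 (a : nat -> nat -> R) :
    (forall n k, 0 <= a n k <= 1) ->
    (forall K (eps : R), 0 < eps ->
      \forall n \near \oo, forall k, (0 < k <= K)%N -> a n k <= eps) ->
  \big[+%R/0]_(1 <= k <oo) (2 ^- k * a n k) @[n --> \oo] --> (0 : R).
Proof.
move=> a01 ha; apply/cvgr0Pnorm_le => e e0.
have [K Ke] : exists K, 2 ^- K <= e / 2 :> R.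
  have /cvgr0Pnorm_le/(_ (e / 2)) : (fun k => 2^-1 ^+ k) @ \oo --> (0 : R).
    by apply: cvg_expr; rewrite ger0_norm ?invr_ge0// invf_lt1// ltr1n.
  rewrite divr_gt0// => /(_ isT)[K _ /(_ K (leqnn K))].
  by rewrite ger0_norm ?exprn_ge0 ?invr_ge0// exprVn => ?; exists K.
have e20 : 0 < e / 2 by rewrite divr_gt0.
apply: filterS (ha K _ e20) => n aK.
have /andP[h0 h1] := weighted_series_bound _ _ _ (ltW e20) (a01 n) aK.
by rewrite ger0_norm//; move: (2 ^- K) h1 Ke => q; lra.
Qed.

End WeightedSeries.

(** Handles limits relative to [Rplus] or its square when the inner map is continuous everywhere:
    projections, truncation at 0, the exit time. *)
Lemma cvg_within_comp {T U V : topologicalType} (A : set T) (B : set U)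
    (f : T -> U) (g : U -> V) (x : T) :
    {for x, continuous f} -> (forall z, A z -> B (f z)) ->
    g z @[z --> within B (nbhs (f x))] --> g (f x) ->
  g (f z) @[z --> within A (nbhs x)] --> g (f x).
Proof.
move=> fx AB gfx W /gfx /fx /=; rewrite /fmap /within/= !nbhs_simpl/=.
by apply: filterS => z /= BW /AB /BW.
Qed.

Section Norms.
Context {R : realType}.
Implicit Types (A : set R) (w : R -> R) (g : R -> R -> R).

(** The default value of [sup] is 0, so the bound survives when no supremum exists. *)
Lemma sup_nonneg A : (forall y, A y -> 0 <= y) -> 0 <= sup A.
Proof.
move=> A0; have [[ne ub]|/sup_out->//] := pselect (has_sup A).
by case: ne => y Ay; apply: (le_trans (A0 _ Ay)); exact: ub_le_sup.
Qed.

Lemma min1_sup_itv A : (forall y, A y -> 0 <= y) ->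
  0 <= Num.min 1 (sup A) <= 1.
Proof. by move=> A0; rewrite le_min ler01 sup_nonneg//= ge_min lexx. Qed.

Lemma norm_Rplus_cvg0 (h_ : nat -> R -> R) :
    (forall (K : nat) (eps : R), 0 < eps ->
      \forall n \near \oo, forall x, 0 <= x <= K%:R -> `|h_ n x| <= eps) ->
  norm_Rplus (h_ n) @[n --> \oo] --> (0 : R).
Proof.
move=> hu; apply: weighted_series_cvg0 => [n k|K eps eps0].
  by apply: min1_sup_itv => _ [t _ <-].
apply: filterS (hu K _ eps0) => n hn k /andP[_ kK].
rewrite ge_min; apply/orP; right; apply: ge_sup.
  by exists `|h_ n 0|, 0 => //=; rewrite in_itv/= lexx ler0n.
move=> _ [t /= + <-]; rewrite in_itv/= => /andP[t0 tk].
by apply: hn; rewrite t0 (le_trans tk)// ler_nat.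
Qed.

Lemma norm_Rplus2_cvg0 (h_ : nat -> R -> R -> R) :
    (forall (K : nat) (eps : R), 0 < eps -> \forall n \near \oo,
      forall t x, 0 <= t <= K%:R -> 0 <= x <= K%:R -> `|h_ n t x| <= eps) ->
  norm_Rplus2 (h_ n) @[n --> \oo] --> (0 : R).
Proof.
move=> hu; apply: weighted_series_cvg0 => [n k|K eps eps0].
  by apply: min1_sup_itv => _ [t _ [x _ <-]].
apply: filterS (hu K _ eps0) => n hn k /andP[_ kK].
rewrite ge_min; apply/orP; right; apply: ge_sup.
  exists `|h_ n 0 0|, 0 => /=; first by rewrite in_itv/= lexx ler0n.
  by exists 0 => //=; rewrite in_itv/= lexx ler0n.
move=> _ [t /= + [x /= + <-]]; rewrite !in_itv/= => /andP[t0 tk] /andP[x0 xk].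
by apply: hn; rewrite ?t0 ?x0 (le_trans tk, le_trans xk)// ler_nat.
Qed.

(** The norm controls one square at a time through a single term of the series. Boundedness is
    assumed because [sup] of an unbounded set is 0, which would hide large values. *)
Lemma norm_Rplus2_cvg0_unif (h_ : nat -> R -> R -> R) :
    (forall n k, (0 < n)%N -> exists M, forall t x,
      0 <= t <= k%:R -> 0 <= x <= k%:R -> `|h_ n t x| <= M) ->
    norm_Rplus2 (h_ n) @[n --> \oo] --> (0 : R) ->
  forall (k : nat) (eps : R), 0 < eps -> \forall n \near \oo,
    forall t x, 0 <= t <= k%:R -> 0 <= x <= k%:R -> `|h_ n t x| <= eps.
Proof.
move=> bnd h0 k eps eps0.
(* The series starts at index 1, so the square of side 0 is treated inside that of side 1. *)
wlog k0 : k / (0 < k)%N => [hw|].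
  apply: filterS (hw k.+1 isT) => n hn t x /andP[t0 tk] /andP[x0 xk].
  by apply: hn; rewrite ?t0 ?x0 (le_trans tk, le_trans xk)// ler_nat.
(* Keeping [d] below 1 ensures that [Num.min 1 (sup A) <= d] bounds [sup A] itself. *)
pose d := Num.min eps 2^-1.
have d0 : 0 < d by rewrite lt_min eps0 invr_gt0 ltr0n.
have p0 : 0 < 2 ^- k :> R by rewrite invr_gt0 exprn_gt0.
have pd : 0 < 2 ^- k * d by rewrite mulr_gt0.
have /cvgr0Pnorm_le/(_ _ pd) hn := h0.
apply: filterS (filterI (nbhs_infty_gt 0) hn) => n /= [n0 {}hn] t x tk xk.
set A := [set `|h_ n t x| | t in `[0, k%:R] & x in `[0, k%:R]].
have ub : has_ubound A.
  have [M hM] := bnd n k n0; exists M => _ [s /= + [y /= + <-]].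
  by rewrite !in_itv/= => *; exact: hM.
have Ad : Num.min 1 (sup A) <= d.
  rewrite -(ler_pM2l p0) (le_trans _ hn)// (le_trans _ (ler_norm _))//.
  apply: (@weighted_series_ge _ (fun k => Num.min 1
    (sup [set `|h_ n t x| | t in `[0, k%:R] & x in `[0, k%:R]]))) => // j.
  by apply: min1_sup_itv => _ [s _ [y _ <-]].
have sA : sup A <= d.
  move: Ad; rewrite ge_min => /orP[|//] d1.
  have : d <= 2^-1 by rewrite ge_min lexx orbT.
  by lra.
apply: (@le_trans _ _ d); last by rewrite ge_min lexx.
apply: le_trans sA; apply: ub_le_sup => //.
by exists t; rewrite /= ?in_itv//=; exists x; rewrite /= ?in_itv.
Qed.

End Norms.

(** * Convergence of monotone functions *)

Section MonotoneConvergence.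
Context {R : realType}.

(* Polya: on a small interval [c, d] around x, monotonicity squeezes f_n
   between its values at c and d, where pointwise convergence applies. *)
Lemma homo_cvg_unif (f_ : nat -> R -> R) (f : R -> R) (a b : R) :
    (forall n, (0 < n)%N -> {homo f_ n : x y / x <= y}) -> continuous f ->
    (forall x, f_ n x @[n --> \oo] --> f x) ->
  forall eps, 0 < eps ->
    \forall n \near \oo, forall x, a <= x <= b -> `|f_ n x - f x| <= eps.
Proof.
move=> homf cf cvf eps eps0.
(* Compactness reduces the uniform claim to one valid jointly for [y] near [x] and [n] large. *)
have /compact_near_coveringP/(_ nat \oo
  (fun n x => `|f_ n x - f x| <= eps) _) H := @segment_compact R a b.
suff : \forall n \near \oo, `[a, b]%classic `<=` (fun x => `|f_ n x - f x| <= eps).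
  by apply: filterS => n + x xab; apply; rewrite /= in_itv.
apply: H => x _.
have e4 : 0 < eps / 4 by rewrite divr_gt0.
have /cvgrPdist_le/(_ _ e4)/nbhs_ballP[r /= r0 hr] := cf x.
have hr' y : `|y - x| < r -> `|f x - f y| <= eps / 4.
  by move=> yr; apply: hr; rewrite /ball/= distrC.
have r2 : 0 < r / 2 by rewrite divr_gt0.
(* The squeezing points [x - r / 2] and [x + r / 2] may leave [[a, b]], which is why the convergence
   is assumed on the whole line. *)
have /cvgrPdist_le/(_ _ e4) hc := cvf (x - r / 2).
have /cvgrPdist_le/(_ _ e4) hd := cvf (x + r / 2).
exists (ball x (r / 2), [set n | [/\ (0 < n)%N,
  `|f (x - r / 2) - f_ n (x - r / 2)| <= eps / 4 &
  `|f (x + r / 2) - f_ n (x + r / 2)| <= eps / 4]]).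
  split => /=; first exact: nbhsx_ballx.
  near=> n; split; near: n => //; exact: nbhs_infty_gt.
move=> [y n] /= [+ [n0]]; rewrite /ball/= ltr_distlC => /andP[y1 y2].
rewrite !ler_distl => /andP[c1 c2] /andP[d1 d2].
have : f_ n (x - r / 2) <= f_ n y by apply: homf => //; lra.
have : f_ n y <= f_ n (x + r / 2) by apply: homf => //; lra.
have := hr' (x - r / 2); rewrite ltr_distl => /(_ ltac:(apply/andP; split; lra)).
have := hr' (x + r / 2); rewrite ltr_distl => /(_ ltac:(apply/andP; split; lra)).
have := hr' y; rewrite ltr_distl => /(_ ltac:(apply/andP; split; lra)).
rewrite !ler_distl => /andP[? ?] /andP[? ?] /andP[? ?] ? ?.
by apply/andP; split; lra.
Unshelve. all: by end_near. Qed.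

End MonotoneConvergence.

(** * Fields of class G: boundedness on squares and the limit field *)

Section ClassG.
Context {R : realType}.
Implicit Types (g : R -> R -> R) (theta w : R -> R).

Lemma classG_bounded g (k : nat) : classG g ->
  exists M, forall t x, 0 <= t <= k%:R -> 0 <= x <= k%:R -> `|g t x| <= M.
Proof.
move=> [cg _ _ _ _].
pose K := `[(0 : R), k%:R]%classic.
have cK : compact (K `*` K) by apply: compact_setX; exact: segment_compact.
have cnorm : {within K `*` K, continuous (fun p : R * R => `|g p.1 p.2|)}.
  have sub : K `*` K `<=` Rplus `*` Rplus.
    move=> -[t x] [] /=; rewrite /K /Rplus/= !in_itv/= !andbT.
    by move=> /andP[-> _] /andP[-> _].
  have {}cg := continuous_subspaceW sub cg.
  by move=> p; apply: cvg_norm; exact: cg.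
have K0 : K 0 by rewrite /K/= in_itv/= lexx ler0n.
have [] := compact_EVT_max _ cK cnorm; first by exists (0, 0); split.
move=> p _ hp; exists `|g p.1 p.2| => t x tk xk.
by apply: (hp (t, x)); rewrite inE; split; rewrite /K/= in_itv.
Qed.

(** Condition (iii) comes from the unboundedness of [w], condition (iv) from that of [theta]. *)
Lemma classG_sub theta w : classTheta theta -> classW w ->
  classG (fun t x => theta t - w x).
Proof.
move=> [cth inc th0 thy] [cw w0 wy]; split.
- apply/subspace_continuousP => -[t x] [/= Rt Rx]; apply: cvgB => /=.
    apply: (cvg_within_comp _ Rplus (@fst R R) theta) => [|z []//|].
      exact: cvg_fst.
    by move/subspace_continuousP : cth; exact.
  apply: (cvg_within_comp _ Rplus (@snd R R) w) => [|z []//|].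
    exact: cvg_snd.
  by move/subspace_continuousP : cw; exact.
- by rewrite th0 sub0r oppr_ge0.
- by move=> x _ s t s0 t0 st; rewrite ltrD2r; exact: inc.
- move=> t _.
  have /ereal_sup_gt[_ [x Rx <-]] :
      ((theta t)%:E < ereal_sup [set (w x)%:E | x in Rplus])%E.
    by rewrite wy ltry.
  rewrite lte_fin => wt.
  apply: (@le_lt_trans _ _ (theta t - w x)%:E); last by rewrite lte_fin subr_lt0.
  by apply: ereal_inf_lbound; exists x.
- move=> x _.
  have /cvgryPgt/(_ (w x)) hw := thy.
  have [t [wt t0]] := filter_ex (filterI hw (nbhs_pinfty_gt (@num_real R 0))).
  apply: (@lt_le_trans _ _ (theta t - w x)%:E); first by rewrite lte_fin subr_gt0.
  apply: ereal_sup_ubound; exists t => //.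
  by rewrite /Rplus/= in_itv/= andbT ltW.
Qed.

End ClassG.

(** * Global solutions are strictly increasing and unbounded *)

Section Crossings.
Context {R : realType}.
Implicit Types (psi : R -> R).

(** The crossing time is the supremum of the times in [[a, b]] at which [psi] is at most [y];
    continuity excludes both strict inequalities there. *)
Lemma last_crossing psi (a b y : R) : continuous psi -> a <= b ->
    psi a < y -> y < psi b ->
  exists c, [/\ a < c < b, psi c = y & forall u, c < u <= b -> y < psi u].
Proof.
move=> cpsi ab ya yb.
pose S := [set u | a <= u <= b /\ psi u <= y].
have Sa : S a by split; [rewrite lexx|exact: ltW].
have hS : has_sup S by split; [exists a|exists b => u [/andP[]]].
pose c := sup S.
have ac : a <= c by apply: ub_le_sup => //; case: hS.
have cb : c <= b by apply: ge_sup; [exists a|move=> u [/andP[]]].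
have cu u : c < u <= b -> y < psi u.
  move=> /andP[cu ub]; rewrite ltNge; apply/negP => uy.
  have : u <= c by apply: ub_le_sup; [case: hS|split => //; apply/andP; split; lra].
  by lra.
have cy : psi c <= y.
  rewrite leNgt; apply/negP => yc.
  have /nbhs_ballP[r /= r0 hr] : \forall u \near c, y < psi u.
    exact: cvgr_gt (cpsi c) _ yc.
  have [u [/andP[au ub] uy] ]  := sup_adherent r0 hS.
  rewrite -/c => cru.
  have uc : u <= c by apply: ub_le_sup; [case: hS|split => //; apply/andP].
  have := hr u; rewrite /ball/= ltr_distlC => /(_ ltac:(apply/andP; split; lra)).
  by lra.
have yc : y <= psi c.
  rewrite leNgt; apply/negP => cy'.
  have cltb : c < b.
    by rewrite lt_neqAle cb andbT; apply/eqP => cb'; move: cy'; rewrite cb'; lra.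
  have /nbhs_ballP[r /= r0 hr] : \forall u \near c, psi u < y.
    exact: cvgr_lt (cpsi c) _ cy'.
  (* At this point, just to the right of [c] and capped by [b], [psi] would be both below and above
     [y]. *)
  pose u := Num.min b (c + r / 2).
  have cltu : c < u by rewrite lt_min cltb/=; lra.
  have ub : u <= b by rewrite ge_min lexx.
  have ur : u <= c + r / 2 by rewrite ge_min lexx orbT.
  have := hr u; rewrite /ball/= ltr_distlC => /(_ ltac:(apply/andP; split; lra)).
  by have := cu u; rewrite cltu ub => /(_ isT); lra.
have cE : psi c = y by apply/eqP; rewrite eq_le cy yc.
exists c; split => //; rewrite !lt_neqAle ac cb !andbT.
apply/andP; split; apply/eqP => E.
  by move: ya; rewrite E cE ltxx.
by move: yb; rewrite -E cE ltxx.
Qed.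

(** Time reversal of [last_crossing]. *)
Lemma first_crossing psi (a b y : R) : continuous psi -> a <= b ->
    y < psi a -> psi b < y ->
  exists c, [/\ a < c < b, psi c = y & forall u, a <= u < c -> y < psi u].
Proof.
move=> cpsi ab ya yb.
have [||||c [/andP[bc ca] cy cu]] :=
    @last_crossing (fun u => psi (- u)) (- b) (- a) y.
- by move=> u; apply: continuous_comp; [exact: opp_continuous|exact: cpsi].
- by rewrite lerN2.
- by rewrite opprK.
- by rewrite opprK.
exists (- c); split => //; first by apply/andP; split; lra.
move=> u /andP[au uc]; rewrite -(opprK u); apply: cu.
by apply/andP; split; lra.
Qed.

End Crossings.

Section Solutions.
Context {R : realType}.
Implicit Types (f g : R -> R -> R) (phi : R -> R) (s t e : R).

Lemma solution_nonneg f phi : global_solution f phi ->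
  forall t, 0 <= t -> 0 <= phi t.
Proof.
move=> [_ pos _] t t0; have := pos t.
by rewrite /Rplus/= !in_itv/= !andbT; exact.
Qed.

Lemma solution_dnbhs f phi t : global_solution f phi -> 0 <= t ->
  forall e, 0 < e -> \forall s \near t, s != t -> 0 <= s ->
    `|f t (phi t) - (phi s - phi t) / (s - t)| <= e.
Proof.
move=> [_ _ dphi] t0 e e0.
have Rt : Rplus t by rewrite /Rplus/= in_itv/= t0.
have /cvgrPdist_le/(_ e e0) := dphi t Rt.
rewrite !near_withinE; apply: filterS => s H st s0.
by apply: H => //; rewrite /Rplus/= in_itv/= s0.
Qed.

Lemma solution_right_diff f phi t : global_solution f phi -> 0 <= t ->
  (phi s - phi t) / (s - t) @[s --> t^'+] --> f t (phi t).
Proof.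
move=> sol t0; apply/cvgrPdist_le => e e0; rewrite near_withinE.
apply: filterS (solution_dnbhs _ _ _ sol t0 e e0) => s H ts.
by apply: H; [rewrite gt_eqF|exact: ltW (le_lt_trans t0 ts)].
Qed.

Lemma solution_left_diff f phi t : global_solution f phi -> 0 < t ->
  (phi s - phi t) / (s - t) @[s --> t^'-] --> f t (phi t).
Proof.
move=> sol t0; apply/cvgrPdist_le => e e0; rewrite near_withinE.
apply: filterS (filterI (lt_nbhsr t0)
  (solution_dnbhs _ _ _ sol (ltW t0) e e0)) => s [s0 H] ts.
by apply: H; [rewrite lt_eqF|exact: ltW].
Qed.

(** The sign of the right difference quotient passes to the limit. Only the future of the path is
    involved, so time 0 is allowed. *)
Lemma solution_rate_ge0 f phi t : global_solution f phi -> 0 <= t ->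
  (\forall s \near t^'+, phi t <= phi s) -> 0 <= f t (phi t).
Proof.
move=> sol t0 inc; apply: (cvgr_to_ge (solution_right_diff _ _ _ sol t0)).
near=> s.
have ts : t <= s by near: s; exact: nbhs_right_ge.
have phits : phi t <= phi s by near: s.
by apply: divr_ge0; rewrite subr_ge0.
Unshelve. all: by end_near. Qed.

Lemma solution_rate_le0 f phi t : global_solution f phi -> 0 <= t ->
  (\forall s \near t^'+, phi s <= phi t) -> f t (phi t) <= 0.
Proof.
move=> sol t0 dec; apply: (cvgr_to_le (solution_right_diff _ _ _ sol t0)).
near=> s.
have ts : t <= s by near: s; exact: nbhs_right_ge.
have phits : phi s <= phi t by near: s.
by rewrite mulr_le0_ge0 ?subr_le0 ?invr_ge0 ?subr_ge0.
Unshelve. all: by end_near. Qed.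

(** Meant for a first downward crossing, where only the past of the path is controlled. *)
Lemma solution_rate_le0_left f phi t : global_solution f phi -> 0 < t ->
  (\forall s \near t^'-, phi t <= phi s) -> f t (phi t) <= 0.
Proof.
move=> sol t0 dec; apply: (cvgr_to_le (solution_left_diff _ _ _ sol t0)).
near=> s.
have ts : s <= t by near: s; exact: nbhs_left_le.
have phits : phi t <= phi s by near: s.
by rewrite mulr_ge0_le0 ?subr_ge0 ?invr_le0 ?subr_le0.
Unshelve. all: by end_near. Qed.

Lemma solution_continuous_within f phi t : global_solution f phi -> 0 <= t ->
  phi s @[s --> within Rplus (nbhs t)] --> phi t.
Proof.
move=> sol t0; apply/cvgrPdist_le => e e0; rewrite near_withinE.
(* Near [t] the difference quotient is within 1 of its limit, so [M] bounds it and a distance of at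
   most [e / M] suffices. *)
pose M := `|f t (phi t)| + 1.
have M0 : 0 < M by rewrite ltr_pwDr.
have eM : 0 < e / M by rewrite divr_gt0.
near=> s; rewrite /Rplus/= in_itv/= andbT => s0.
have [->|st] := eqVneq s t; first by rewrite subrr normr0 ltW.
have q1 : `|f t (phi t) - (phi s - phi t) / (s - t)| <= 1.
  by move: st s0; near: s; exact: solution_dnbhs.
have d1 : `|t - s| <= e / M.
  by near: s; move/cvgrPdist_le : (@cvg_id _ (nbhs t)); exact.
have qM : `|(phi s - phi t) / (s - t)| <= M.
  rewrite -[X in `|X|](subKr (f t (phi t))).
  by rewrite (le_trans (ler_normB _ _))// lerD2l.
rewrite distrC -[_ - _](@divfK _ (s - t)) ?subr_eq0// normrM.
by rewrite -[leRHS](@divfK _ M) ?gt_eqF// [leRHS]mulrC ler_pM// distrC.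
Unshelve. all: by end_near. Qed.

(** Freezing the path at its initial value for negative times gives a function continuous on the
    whole line, as the crossing lemmas require. *)
Lemma solution_continuous_max f phi : global_solution f phi ->
  continuous (fun s => phi (Num.max 0 s)).
Proof.
move=> sol t.
suff : phi (Num.max 0 s) @[s --> within [set: R] (nbhs t)] --> phi (Num.max 0 t).
  by rewrite withinET.
apply: (@cvg_within_comp _ _ _ [set: R] Rplus (fun s : R => Num.max 0 s)).
- by apply: continuous_max; [exact: cvg_cst|exact: cvg_id].
- by move=> s _; rewrite /Rplus/= in_itv/= andbT le_max lexx.
- by apply: solution_continuous_within sol _; rewrite le_max lexx.
Qed.

Lemma solution_is_derive f phi t : global_solution f phi -> 0 < t ->
  is_derive t 1 phi (f t (phi t)).
Proof.
move=> sol t0; apply/is_derive1_caratheodory.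
exists (fun z => if z == t then f t (phi t) else (phi z - phi t) / (z - t)).
split; last by rewrite eqxx.
  move=> z; case: eqVneq => [->|zt]; first by rewrite !subrr mulr0.
  by rewrite divfK// subr_eq0.
apply/cvgrPdist_le => e e0; rewrite eqxx.
apply: filterS (filterI (lt_nbhsr t0)
  (solution_dnbhs _ _ _ sol (ltW t0) e e0)) => s [s0 H].
case: eqVneq => [_|st]; first by rewrite subrr normr0 ltW.
by apply: H => //; exact: ltW.
Qed.

(** Mean value theorem; [a] is positive because the two-sided derivative is available only at
    positive times. *)
Lemma solution_growth f phi (a b m : R) : global_solution f phi ->
    0 < a -> a <= b -> (forall t, a <= t <= b -> m <= f t (phi t)) ->
  m * (b - a) <= phi b - phi a.
Proof.
move=> sol a0 ab hm.
have [||c] := @MVT_segment R phi (fun t => f t (phi t)) a b ab.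
- move=> t; rewrite in_itv/= => /andP[ta _].
  exact: solution_is_derive sol (lt_trans a0 ta).
- apply: derivable_within_continuous => t; rewrite in_itv/= => /andP[ta _].
  by case: (solution_is_derive _ _ _ sol (lt_le_trans a0 ta)).
rewrite in_itv/= => /hm mc ->.
by rewrite ler_wpM2r// subr_ge0.
Qed.

(* If the solution exceeded a level y and came back below it, then g would be
   nonnegative at the last upward crossing of y and nonpositive at the next
   downward crossing, against the strict monotonicity of g in time. *)
Lemma solution_nondecreasing g phi (c : R) : 0 < c -> classG g ->
    global_solution (fun t x => c * g t x) phi ->
  forall s r, 0 <= s -> s <= r -> phi s <= phi r.
Proof.
move=> c0 [_ _ inc _ _] sol s r s0 sr.
have psiE u : 0 <= u -> phi (Num.max 0 u) = phi u by move=> u0; rewrite max_r.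
rewrite leNgt; apply/negP => rs.
have phi0 : phi 0 = 0 by case: sol.
have r0 := solution_nonneg _ _ sol r (le_trans s0 sr).
(* A level strictly between the two values; it is positive since [phi r] is nonnegative, so the
   path, starting from 0, must first cross it upwards before [s]. *)
pose y := (phi r + phi s) / 2.
have ry : phi r < y by rewrite /y; lra.
have ys : y < phi s by rewrite /y; lra.
have cpsi := solution_continuous_max _ _ sol.
have [||c1 [/andP[c10 c1s]]] := last_crossing _ 0 s y cpsi s0.
- by rewrite psiE// phi0; lra.
- by rewrite psiE.
rewrite psiE ?(ltW c10)// => c1y c1u.
have [||c2 [/andP[c2s c2r]]] := first_crossing _ s r y cpsi sr.
- by rewrite psiE.
- by rewrite psiE//; lra.
rewrite psiE; last lra.
move=> c2y c2u.
have : 0 <= c * g c1 (phi c1).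
  apply: (solution_rate_ge0 _ _ _ sol (ltW c10)).
  near=> u.
  have uc1 : c1 < u by near: u; exact: nbhs_right_gt.
  rewrite c1y ltW// -(psiE u); last lra.
  apply: c1u; rewrite uc1/=; near: u; exact: nbhs_right_le.
have : c * g c2 (phi c2) <= 0.
  apply: (solution_rate_le0_left _ _ _ sol); first lra.
  near=> u.
  have uc2 : u < c2 by near: u; exact: nbhs_left_lt.
  have us : s <= u by near: u; exact: nbhs_left_ge.
  rewrite c2y ltW// -(psiE u); last lra.
  by apply: c2u; rewrite us.
rewrite c1y c2y pmulr_rle0// pmulr_rge0//.
have : g c1 y < g c2 y.
  by apply: inc; rewrite /Rplus/= ?in_itv/= ?andbT; lra.
by lra.
Unshelve. all: by end_near. Qed.

(** On a flat stretch the speed would be 0 at two different times and the same level, which the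
    strict monotonicity of [g] in time forbids. *)
Lemma solution_strictly_increasing g phi (c : R) : 0 < c -> classG g ->
    global_solution (fun t x => c * g t x) phi -> strictly_increasing phi.
Proof.
move=> c0 Gg sol s t; rewrite !in_itv/= !andbT => s0 t0 st.
have nd := solution_nondecreasing _ _ _ c0 Gg sol.
rewrite lt_neqAle nd ?(ltW st)// andbT; apply/eqP => est.
pose u := s + (t - s) / 3; pose v := s + (t - s) / 3 * 2.
have phiE z : s <= z <= t -> phi z = phi s.
  by move=> /andP[sz zt]; apply/eqP; rewrite eq_le {1}est !nd//; lra.
have su : s < u by rewrite /u; lra.
have uv : u < v by rewrite /u /v; lra.
have vt : v < t by rewrite /v; lra.
have : 0 <= c * g u (phi u).
  apply: (solution_rate_ge0 _ _ _ sol); first lra.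
  by near=> z; apply: nd; [lra|near: z; exact: nbhs_right_ge].
have : c * g v (phi v) <= 0.
  apply: (solution_rate_le0 _ _ _ sol); first lra.
  near=> z; have vz : v <= z by near: z; exact: nbhs_right_ge.
  have zt : z <= t by near: z; exact: nbhs_right_le.
  by rewrite !phiE// ?vz ?zt ?andbT//=; lra.
rewrite !phiE; try by apply/andP; split; lra.
rewrite pmulr_rle0// pmulr_rge0//.
have : g u (phi s) < g v (phi s).
  case: Gg => _ _ inc _ _; apply: inc.
  - by rewrite /Rplus/= in_itv/= andbT (solution_nonneg _ _ sol).
  - by rewrite in_itv/= andbT; lra.
  - by rewrite in_itv/= andbT; lra.
  - by [].
by lra.
Unshelve. all: by end_near. Qed.

(** A bounded path approaches its supremum [L]. By condition (iv) and continuity, [g] at some time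
    [T] is at least [d > 0] near [L]; monotonicity in time keeps the speed above [c * d] afterwards,
    so the path would pass [L]. *)
Lemma solution_unbounded g phi (c : R) : 0 < c -> classG g ->
    global_solution (fun t x => c * g t x) phi ->
  forall A, exists2 t, 0 <= t & A <= phi t.
Proof.
move=> c0 Gg sol A.
have nd := solution_nondecreasing _ _ _ c0 Gg sol.
have pos := solution_nonneg _ _ sol.
apply: contrapT => nA.
have bA t : 0 <= t -> phi t <= A.
  move=> t0; rewrite leNgt; apply/negP => At; apply: nA; exists t => //.
  exact: ltW.
pose S := [set phi t | t in Rplus].
have S0 : S (phi 0) by exists 0; rewrite // /Rplus/= in_itv/= lexx.
have ubS : has_ubound S.
  by exists A => _ [t + <-]; rewrite /Rplus/= in_itv/= andbT; exact: bA.
have hS : has_sup S by split => //; exists (phi 0).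
pose L := sup S.
have phiL t : 0 <= t -> phi t <= L.
  by move=> t0; apply: ub_le_sup => //; exists t; rewrite // /Rplus/= in_itv/= t0.
have L0 : 0 <= L by rewrite (le_trans (pos 0 _))// phiL.
have RL : Rplus L by rewrite /Rplus/= in_itv/= L0.
case: Gg => cg _ inc _ /(_ _ RL)/ereal_sup_gt[_ [T RT <-]].
rewrite lte_fin => gT.
have T0 : 0 <= T by move: RT; rewrite /Rplus/= in_itv/= andbT.
have gL : \forall x \near L, 0 <= x -> g T L / 2 <= g T x.
  have cgT : g T x @[x --> within Rplus (nbhs L)] --> g T L.
    apply: (cvg_within_comp _ (Rplus `*` Rplus) (fun x => (T, x))
      (fun p : R * R => g p.1 p.2)) => [|x //|].
      by apply: (@cvg_pair _ _ _ (nbhs L) (nbhs T) (nbhs L) _ _ _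
        (fun=> T) id); [exact: cvg_cst|exact: cvg_id].
    by move/subspace_continuousP : cg; apply.
  have lt2 : g T L / 2 < g T L by lra.
  have : \forall x \near within Rplus (nbhs L), g T L / 2 <= g T x.
    exact: cvgr_ge cgT _ lt2.
  rewrite near_withinE; apply: filterS => x H x0; apply: H.
  by rewrite /Rplus/= in_itv/= x0.
have /nbhs_ballP[r /= r0 hr] := gL.
have [_ [t1 + <-] t1r] := sup_adherent r0 hS.
rewrite /Rplus/= in_itv/= andbT => t10.
(* From [t2] on, the time exceeds [T] and the path stays within [r] of [L]. *)
pose t2 := T + t1 + 1.
pose d := g T L / 2.
have d0 : 0 < d by rewrite /d; lra.
(* Long enough for a gain of [L + 1] at speed [c * d], impossible inside [[0, L]]. *)
pose t3 := t2 + (L + 1) / (c * d).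
have cd0 : 0 < c * d by rewrite mulr_gt0.
have t23 : t2 <= t3 by rewrite lerDl divr_ge0// ?addr_ge0// ltW.
have := @solution_growth _ phi t2 t3 (c * d) sol.
have -> : c * d * (t3 - t2) = L + 1.
  by rewrite /t3 addrAC subrr add0r mulrC divfK ?gt_eqF.
have t20 : 0 < t2 by rewrite /t2; lra.
move=> /(_ t20 t23) H.
have {H} : L + 1 <= phi t3 - phi t2.
  apply: H => t /andP[t2t _].
  have tt1 : t1 <= t by move: t2t; rewrite /t2; lra.
  have t0 : 0 <= t by lra.
  rewrite ler_pM2l// (@le_trans _ _ (g T (phi t)))//.
    apply: hr; last exact: pos.
    have := nd _ _ t10 tt1; have := phiL _ t0.
    by rewrite /ball/= ltr_distlC => *; apply/andP; split; move: t1r; rewrite -/L; lra.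
  apply: ltW; apply: inc; rewrite ?in_itv/= ?andbT//.
    by rewrite /Rplus/= in_itv/= pos.
  by move: t2t; rewrite /t2; lra.
have := phiL t3 ltac:(lra); have := pos t2 (ltW t20).
by lra.
Qed.

Lemma solution_Phibar g phi (c : R) : 0 < c -> classG g ->
  global_solution (fun t x => c * g t x) phi -> Phibar phi.
Proof.
move=> c0 Gg sol.
have nd := solution_nondecreasing _ _ _ c0 Gg sol.
split; first by case: sol.
- split=> t t0.
    have /cvgrPdist_le ct := solution_continuous_within _ _ _ sol t0.
    apply/cvgrPdist_le => e /ct; rewrite !near_withinE.
    apply: filterS => s H ts; apply: H.
    by rewrite /Rplus/= in_itv/= andbT (le_trans t0 (ltW ts)).
  apply/cvg_ex; exists (phi t).
  have /cvgrPdist_le ct := solution_continuous_within _ _ _ sol (ltW t0).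
  apply/cvgrPdist_le => e /ct; rewrite !near_withinE => H.
  apply: filterS (filterI (lt_nbhsr t0) H) => s [/= s0 {}H] _.
  by apply: H; rewrite /Rplus/= in_itv/= andbT ltW.
- exact: solution_strictly_increasing c0 Gg sol.
- apply/cvgryPge => A; have [t t0 At] := solution_unbounded _ _ _ c0 Gg sol A.
  near=> s; apply: (le_trans At); apply: nd t0 _.
  near: s; exact: nbhs_pinfty_ge (num_real t).
Unshelve. all: by end_near. Qed.

End Solutions.

(** * Convergence of the solutions *)

Section Convergence.
Context {R : realType}.
Implicit Types (phi theta w : R -> R) (g : R -> R -> R) (x t u : R).

(** The extreme value theorem supplies the upper bound without which [sup] would default to 0. *)
Lemma run_max_ge w x u : {within Rplus, continuous w} -> 0 <= u <= x ->
  w u <= run_max w x.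
Proof.
move=> cw /andP[u0 ux].
have sub : `[0, x] `<=` Rplus.
  by move=> y; rewrite /Rplus/= !in_itv/= => /andP[->].
have [c _ hc] := EVT_max (le_trans u0 ux) (continuous_subspaceW sub cw).
apply: (@le_trans _ _ (Num.max 0 (w u))); first by rewrite le_max lexx orbT.
apply: ub_le_sup; last by exists u; rewrite //= in_itv/= u0.
exists (Num.max 0 (w c)) => _ [v vx <-].
by rewrite ge_max !le_max lexx/= hc ?orbT.
Qed.

Lemma run_max_gt w x (y : R) : 0 <= x -> 0 <= y -> y < run_max w x ->
  exists2 u, 0 <= u <= x & y < w u.
Proof.
move=> x0 y0 /sup_gt[|_ [u ux <-]].
  by exists (Num.max 0 (w 0)), 0; rewrite //= in_itv/= lexx.
rewrite lt_max ltNge y0/= => yu; by exists u.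
Qed.

Lemma nat_upper_bound (a b : R) : exists k : nat, a <= k%:R /\ b <= k%:R.
Proof.
exact: filter_ex (filterI (nbhs_infty_ger a) (nbhs_infty_ger b)).
Qed.

(** At an upward crossing of [u] at a time [s < t] the speed would be nonnegative, whereas
    [g s u < g t u < 0]. *)
Lemma solution_barrier g phi (c : R) x t u : 0 < c -> classG g ->
    global_solution (fun t x => c * g t x) phi ->
    0 <= t -> 0 < u <= x -> g t u < 0 -> t <= exit_time phi x.
Proof.
move=> c0 Gg sol t0 /andP[u0 ux] gtu.
apply: le_exit_time; first exact: solution_Phibar c0 Gg sol.
apply: le_trans ux; rewrite leNgt; apply/negP => uphi.
have nd := solution_nondecreasing _ _ _ c0 Gg sol.
have [||s [/andP[s0 st]]] :=
    last_crossing _ 0 t u (solution_continuous_max _ _ sol) t0.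
- by rewrite max_r//; case: sol => ->.
- by rewrite max_r.
rewrite max_r ?ltW// => su _.
have : 0 <= c * g s (phi s).
  apply: (solution_rate_ge0 _ _ _ sol (ltW s0)).
  by near=> z; apply: nd; [exact: ltW|near: z; exact: nbhs_right_ge].
rewrite su pmulr_rge0//.
have : g s u < g t u.
  case: Gg => _ _ inc _ _; apply: inc => //.
  - by rewrite /Rplus/= in_itv/= andbT ltW.
  - by rewrite in_itv/= andbT ltW.
  - by rewrite in_itv/= andbT.
by lra.
Unshelve. all: by end_near. Qed.

(** A path still in [[0, x]] at time [t] has speed at least [c * eta] throughout [[a, t]], hence
    travels more than [x]. *)
Lemma solution_escape g phi (c eta : R) x a t : 0 < c -> classG g ->
    global_solution (fun t x => c * g t x) phi ->
    0 < a -> a <= t -> (forall y, 0 <= y <= x -> eta <= g a y) ->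
    x < c * eta * (t - a) -> exit_time phi x <= t.
Proof.
move=> c0 Gg sol a0 at_ ga big.
have nd := solution_nondecreasing _ _ _ c0 Gg sol.
have pos := solution_nonneg _ _ sol.
have t0 : 0 < t by lra.
apply: exit_time_le => //; rewrite ltNge; apply/negP => phix.
have : c * eta * (t - a) <= phi t - phi a.
  apply: (solution_growth _ _ _ _ _ sol a0 at_) => s /andP[as_ st].
  have s0 : 0 <= s by lra.
  rewrite ler_pM2l// (@le_trans _ _ (g a (phi s)))//.
    by apply: ga; rewrite pos//= (le_trans _ phix)// nd.
  have [->//|/eqP sa] := eqVneq a s.
  apply: ltW; case: Gg => _ _ inc _ _; apply: inc.
  - by rewrite /Rplus/= in_itv/= pos.
  - by rewrite in_itv/= andbT ltW.
  - by rewrite in_itv/= andbT.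
  - by rewrite lt_neqAle as_ andbT; apply/eqP.
by have := pos a (ltW a0); lra.
Qed.

Lemma exit_time_cvg phibar theta w (g_ : nat -> R -> R -> R)
    (phi_ : nat -> R -> R) :
    Phibar phibar -> classTheta theta -> classW w ->
    (forall x, 0 <= x -> run_max w x = theta (exit_time phibar x)) ->
    (forall n, (0 < n)%N -> classG (g_ n)) ->
    (forall (k : nat) (eps : R), 0 < eps -> \forall n \near \oo,
      forall t x, 0 <= t <= k%:R -> 0 <= x <= k%:R ->
        `|theta t - w x - g_ n t x| <= eps) ->
    (forall n, (0 < n)%N ->
       global_solution (fun t x => n%:R * g_ n t x) (phi_ n)) ->
  forall x, exit_time (phi_ n) x @[n --> \oo] --> exit_time phibar x.
Proof.
move=> Pphi [cth inc th0 _] [cw w0 _] hM Gg ug sol x.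
have Pphi_ n : (0 < n)%N -> Phibar (phi_ n).
  move=> n0; apply: solution_Phibar (Gg n n0) (sol n n0).
  by rewrite ltr0n.
apply/cvgrPdist_le => e e0.
have [x0|x0] := ltP x 0.
  apply: filterS (nbhs_infty_gt 0) => n /= n0.
  by rewrite !exit_time_le0 ?subrr ?normr0 ?(ltW x0)// ?(ltW e0)//; exact: Pphi_.
set T := exit_time phibar x.
have T0 : 0 <= T := exit_time_ge0 _ _.
have Mx : run_max w x = theta T := hM x x0.
have lower : \forall n \near \oo, T - e <= exit_time (phi_ n) x.
  have [Te|Te] := ltP (T - e) 0.
    by near=> n; apply: (le_trans (ltW Te)); exact: exit_time_ge0.
  have thTe : theta (T - e) < theta T.
    by apply: inc; rewrite ?in_itv/= ?andbT//; lra.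
  have th_ge0 : 0 <= theta (T - e).
    have [->|Tn0] := eqVneq (T - e) 0; first by rewrite th0.
    rewrite -th0; apply/ltW/inc; rewrite ?in_itv/= ?lexx ?Te//.
    by rewrite lt_neqAle eq_sym Tn0.
  have [u /andP[u0 ux] wu] : exists2 u, 0 <= u <= x & theta (T - e) < w u.
    by apply: run_max_gt; rewrite ?Mx.
  (* [w 0 <= 0 <= theta (T - e) < w u] excludes [u = 0]; the barrier must lie above the starting
     point. *)
  have {}u0 : 0 < u.
    rewrite lt_neqAle u0 andbT; apply/eqP => uE.
    by move: wu w0; rewrite -uE; lra.
  have [k [k1 k2]] := nat_upper_bound (T - e) u.
  (* Half of the gap: an error of this size leaves [g_ n (T - e) u] negative. *)
  have d0 : 0 < (w u - theta (T - e)) / 2 by lra.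
  apply: filterS (filterI (nbhs_infty_gt 0) (ug k _ d0)) => n [/= n0 hn].
  apply: (solution_barrier _ _ _ _ _ u _ (Gg n n0) (sol n n0)) => //.
  - by rewrite ltr0n.
  - by rewrite u0.
  have := hn (T - e) u; rewrite Te k1 (ltW u0) k2 => /(_ isT isT).
  by rewrite ler_norml => /andP[]; lra.
have upper : \forall n \near \oo, exit_time (phi_ n) x <= T + e.
  (* The first half of the delay [e] makes the limit field at least [2 * eta] on [[0, x]], of which
     [eta] absorbs the approximation error; the second half is the time left to escape. *)
  pose a := T + e / 2.
  have a0 : 0 < a by rewrite /a; lra.
  have tha : theta T < theta a.
    by apply: inc; rewrite ?in_itv/= ?andbT /a//; lra.
  pose eta := (theta a - theta T) / 2.
  have eta0 : 0 < eta by rewrite /eta; lra.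
  have ee0 : 0 < eta * (e / 2) by rewrite mulr_gt0//; lra.
  have [k [k1 k2]] := nat_upper_bound a x.
  apply: filterS (filterI (nbhs_infty_gt 0)
    (filterI (ug k _ eta0) (nbhs_infty_gtr (x / (eta * (e / 2))))))
    => n [/= n0 [hn big]].
  apply: (solution_escape _ _ _ eta _ a _ _ (Gg n n0) (sol n n0)) => //.
  - by rewrite ltr0n.
  - by rewrite /a; lra.
  - move=> y /andP[y0 yx].
    have := hn a y; rewrite (ltW a0) k1 y0 (le_trans yx k2) => /(_ isT isT).
    have : w y <= theta T by rewrite -Mx; apply: run_max_ge; rewrite ?y0.
    by rewrite ler_norml /eta => ? /andP[]; lra.
  - have -> : T + e - a = e / 2 by rewrite /a; lra.
    by rewrite -mulrA -ltr_pdivrMr.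
near=> n; rewrite ler_distlC; apply/andP; split; first by near: n.
by near: n.
Unshelve. all: by end_near. Qed.

Lemma cvg_Phibar_exit_time phibar (phi_ : nat -> R -> R) :
    Phibar phibar -> (forall n, (0 < n)%N -> Phibar (phi_ n)) ->
    (forall x, exit_time (phi_ n) x @[n --> \oo] --> exit_time phibar x) ->
  cvg_Phibar phi_ phibar.
Proof.
move=> Pphi Pphi_ cE; split => //.
apply: norm_Rplus_cvg0 => K eps eps0.
have := @homo_cvg_unif R (fun n => exit_time (phi_ n)) (exit_time phibar) 0 K%:R
  (fun n n0 => exit_time_homo _ (Pphi_ n n0)) (exit_time_continuous _ Pphi)
  cE eps eps0.
by apply: filterS => n hn x xK; rewrite distrC; exact: hn.
Qed.

Lemma solutions_cvg_Phibar phibar theta w (g_ : nat -> R -> R -> R)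
    (phi_ : nat -> R -> R) :
    Phibar phibar -> classTheta theta -> classW w ->
    (forall x, 0 <= x -> run_max w x = theta (exit_time phibar x)) ->
    (forall n, (0 < n)%N -> classG (g_ n)) ->
    norm_Rplus2 (fun t x => theta t - w x - g_ n t x) @[n --> \oo]
      --> (0 : R) ->
    (forall n, (0 < n)%N ->
       global_solution (fun t x => n%:R * g_ n t x) (phi_ n)) ->
  cvg_Phibar phi_ phibar.
Proof.
move=> Pphi Tth Ww hM Gg g0 sol.
apply: cvg_Phibar_exit_time => // [n n0|].
  by apply: solution_Phibar (Gg n n0) (sol n n0); rewrite ltr0n.
apply: (exit_time_cvg _ _ _ _ _ Pphi Tth Ww hM Gg _ sol).
apply: norm_Rplus2_cvg0_unif g0 => n k n0.
have [M1 h1] := classG_bounded _ k (classG_sub _ _ Tth Ww).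
have [M2 h2] := classG_bounded _ k (Gg n n0).
exists (M1 + M2) => t x tk xk; rewrite (le_trans (ler_normB _ _))//.
by rewrite lerD ?h1 ?h2.
Qed.

End Convergence.

(** * The example where [w] is [theta] composed with the exit time *)

Section CanonicalExample.
Context {R : realType}.
Implicit Types (phibar theta : R -> R).

Lemma classW_exit_time phibar theta : Phibar phibar -> classTheta theta ->
  classW (fun x => theta (exit_time phibar x)).
Proof.
move=> Pphi [cth inc th0 thy]; split.
- apply/subspace_continuousP => x _.
  apply: (cvg_within_comp Rplus Rplus (exit_time phibar) theta).
  + exact: exit_time_continuous.
  + by move=> z _; rewrite /Rplus/= in_itv/= exit_time_ge0.
  + move/subspace_continuousP : cth; apply.
    by rewrite /Rplus/= in_itv/= exit_time_ge0.
- by rewrite exit_time_le0// th0.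
apply/eqyP => A _.
have /cvgryPge/(_ A) hA := thy.
have [t [At t0]] := filter_ex (filterI hA (nbhs_pinfty_gt (@num_real R 0))).
have [x x0 tx] := exit_time_unbounded _ Pphi t.
apply: (@le_trans _ _ (theta (exit_time phibar x))%:E).
  rewrite lee_fin (le_trans At)//.
  exact: (strictly_increasing_le _ inc _ _ (ltW t0)).
by apply: ereal_sup_ubound; exists x; rewrite // /Rplus/= in_itv/= x0.
Qed.

(** This [w] is nonnegative and nondecreasing, hence its own running maximum. *)
Lemma run_max_exit_time phibar theta : Phibar phibar -> classTheta theta ->
  forall x, 0 <= x -> run_max (fun x => theta (exit_time phibar x)) x =
    theta (exit_time phibar x).
Proof.
move=> Pphi Tth x x0.
have Ww := classW_exit_time _ _ Pphi Tth.
have [_ inc th0 _] := Tth.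
have thE0 y : 0 <= theta (exit_time phibar y).
  by rewrite -{1}th0 strictly_increasing_le// exit_time_ge0.
apply/eqP; rewrite eq_le; apply/andP; split.
  apply: ge_sup.
    by eexists; exists 0; [rewrite /= in_itv/= lexx|reflexivity].
  move=> _ [u /= + <-]; rewrite in_itv/= => /andP[u0 ux].
  rewrite ge_max thE0/= strictly_increasing_le ?exit_time_ge0//.
  exact: exit_time_homo.
apply: (run_max_ge (fun x => theta (exit_time phibar x))).
  by case: Ww.
by rewrite x0 lexx.
Qed.

End CanonicalExample.

(** * Explicit solutions *)

Section Primitive.
Context {R : realType}.

(** Since [f] vanishes on the negative axis, the integral from the fixed base point -1 serves the
    whole line: it is 0 for negative [x], and the fundamental theorem applies on [[-1, x + 1]]
    otherwise. *)
Lemma continuous_primitive (f : R -> R) : continuous f ->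
    (forall x, x <= 0 -> f x = 0) ->
  exists F : R -> R, forall x : R, is_derive x 1 F (f x).
Proof.
move=> cf f0.
pose F (x : R) := \int[@lebesgue_measure R]_(t in `[-1, x]) (f t).
have F0 x : x <= 0 -> F x = 0.
  move=> x0; rewrite /F; under eq_Rintegral.
    move=> t; rewrite inE/= in_itv/= => /andP[_ tx].
    rewrite f0 ?(le_trans tx)//; over.
  by rewrite Rintegral_cst ?mul0r.
exists F => x; have [x0|x0] := ltP x 0.
  rewrite f0 ?(ltW x0)//.
  apply: (@near_eq_is_derive _ _ _ (cst 0)) => //.
    by near=> y; rewrite F0//; near: y; exact: lt_le_nbhsl.
have x1 : -1 < x by lra.
have xu : x < x + 1 by lra.
have intf : (@lebesgue_measure R).-integrable `[-1, x + 1] (EFin \o f).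
  apply: continuous_compact_integrable; first exact: segment_compact.
  by apply: continuous_subspaceT.
have [dF FE] := continuous_FTC1_closed xu intf x1 (cf x).
by apply: DeriveDef => //; rewrite -derive1E.
Unshelve. all: by end_near. Qed.

End Primitive.

Section Inverse.
Context {R : realType}.

Lemma is_derive_quotient (phi : R -> R) (t l : R) (A : set R) :
  is_derive t 1 phi l -> (phi s - phi t) / (s - t) @[s --> within A t^'] --> l.
Proof.
move=> /is_derive1_caratheodory[h [hE ch <-]].
apply/cvgrPdist_le => e e0; rewrite !near_withinE.
move/cvgrPdist_le/(_ e e0) : ch; apply: filterS => s hs st _.
by rewrite hE mulfK// subr_eq0.
Qed.

(* If x(t) inverts psi, then x' = 1 / psi'(x); adding to c^-1 / psi'(x) the
   time lag t - psi(x), which vanishes along the path, does not change this. *)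
Lemma inverse_global_solution (psi d phi : R -> R) (c : R) : 0 < c ->
    psi 0 = 0 -> {homo psi : x y / x < y} ->
    (forall x : R, is_derive x 1 psi (d x)) -> (forall x, 0 < d x) ->
    (forall t, psi (phi t) = t) ->
  global_solution (fun t x => c * (t - psi x + (c * d x)^-1)) phi.
Proof.
move=> c0 psi0 inc dpsi d0 psiK.
have inj_psi : injective psi := inc_inj (le_mono inc).
have phiK x : phi (psi x) = x by apply: inj_psi; rewrite psiK.
have phi0 : phi 0 = 0 by rewrite -{1}psi0 phiK.
split=> // [t|t _].
  by rewrite /Rplus/= !in_itv/= !andbT => t0; rewrite -(le_mono inc) psi0 psiK.
rewrite psiK subrr add0r invfM mulrA divff ?gt_eqF// mul1r.
apply: is_derive_quotient; rewrite -[X in is_derive X](psiK t).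
apply: is_derive_inverse.
- by near=> x; exact: phiK.
- near=> x; apply: differentiable_continuous.
  by apply/derivable1_diffP; case: (dpsi x).
- by rewrite gt_eqF.
Unshelve. all: by end_near. Qed.

End Inverse.

(** * Mollified exit times and the fields solved by their inverses *)

Section SmoothApproximation.
Context {R : realType}.
Context (E F : R -> R).
Implicit Types (n : nat) (x y t : R).

(** The derivative of [mollified]. The added slope [n^(-1/2)] tends to 0, while [n] times it tends
    to infinity, so the slope and the correction in [mollified_field] both vanish in the limit. *)
Definition mollified_rate n x : R :=
  n%:R * (E (x + n%:R^-1) - E x) + Num.sqrt n%:R^-1.

(* The average of F' = E over [x, x + 1/n], shifted to vanish at 0, plus a
   slope making it a strictly increasing bijection. *)
Definition mollified n x : R :=
  n%:R * (F (x + n%:R^-1) - F x) - n%:R * (F (0 + n%:R^-1) - F 0) +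
  Num.sqrt n%:R^-1 * x.

(** The field of [inverse_global_solution] with [c = n], before multiplication by [n]. *)
Definition mollified_field n t x : R :=
  t - mollified n x + (n%:R * mollified_rate n x)^-1.

Context (E_homo : {homo E : x y / x <= y}) (E_cont : continuous E)
  (E0 : E 0 = 0) (dF : forall x : R, is_derive x 1 F (E x)).

Lemma slope_gt0 n : (0 < n)%N -> 0 < Num.sqrt (n%:R^-1 : R).
Proof. by move=> n0; rewrite sqrtr_gt0 invr_gt0 ltr0n. Qed.

Lemma slope_cvg0 : Num.sqrt (n%:R^-1 : R) @[n --> \oo] --> (0 : R).
Proof.
rewrite -[X in _ --> X]sqrtr0.
apply: (cvg_comp (fun n : nat => n%:R^-1 : R) Num.sqrt);
  last exact: sqrt_continuous.
apply/cvgr0Pnorm_le => e e0; near=> n.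
have n0 : (0 < n)%N by near: n; exact: nbhs_infty_gt.
rewrite ger0_norm ?invr_ge0// -[e]invrK lef_pV2 ?posrE ?invr_gt0 ?ltr0n//.
near: n; exact: nbhs_infty_ger.
Unshelve. all: by end_near. Qed.

Lemma mollified_rate_ge n x : Num.sqrt n%:R^-1 <= mollified_rate n x.
Proof.
rewrite lerDr mulr_ge0// subr_ge0; apply: E_homo.
by rewrite lerDl invr_ge0.
Qed.

Lemma mollified_rate_gt0 n x : (0 < n)%N -> 0 < mollified_rate n x.
Proof.
by move=> n0; apply: lt_le_trans (mollified_rate_ge n x); exact: slope_gt0.
Qed.

Lemma is_derive_mollified n x : is_derive x 1 (mollified n) (mollified_rate n x).
Proof.
have dFn : is_derive x 1 (fun y => F (y + n%:R^-1)) (E (x + n%:R^-1)).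
  rewrite -[E _]mulr1.
  apply: (@is_derive1_comp _ F (fun y => y + n%:R^-1)) => //.
  by apply: is_derive_eq; rewrite ?addr0.
rewrite /mollified_rate /mollified.
by apply: is_derive_eq; rewrite subr0 /GRing.scale/= mulr1.
Qed.

Lemma mollified_continuous n : continuous (mollified n).
Proof.
move=> x; apply: differentiable_continuous; apply/derivable1_diffP.
by case: (is_derive_mollified n x).
Qed.

Lemma mollified0 n : mollified n 0 = 0.
Proof. by rewrite /mollified subrr mulr0 addr0. Qed.

Lemma mollified_expanding n x y : x <= y ->
  Num.sqrt n%:R^-1 * (y - x) <= mollified n y - mollified n x.
Proof.
move=> xy; have [c _ ->] := MVT_segment xy
  (fun z _ => is_derive_mollified n z)
  (continuous_subspaceT (mollified_continuous n)).
by rewrite ler_wpM2r ?subr_ge0// mollified_rate_ge.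
Qed.

Lemma mollified_lt n : (0 < n)%N -> {homo mollified n : x y / x < y}.
Proof.
move=> n0 x y xy; rewrite -subr_gt0.
apply: lt_le_trans (mollified_expanding n _ _ (ltW xy)).
by rewrite mulr_gt0 ?subr_gt0// slope_gt0.
Qed.

Lemma mollified_surj n t : (0 < n)%N -> exists x, mollified n x = t.
Proof.
move=> n0; have s0 := slope_gt0 _ n0.
(* By the expansion bound, [mollified n] is at least [|t|] at [r] and at most [-|t|] at [- r]. *)
pose r := `|t| / Num.sqrt n%:R^-1.
have r0 : 0 <= r by rewrite divr_ge0// ltW.
have sr : Num.sqrt n%:R^-1 * r = `|t| by rewrite mulrC divfK ?gt_eqF.
have rr : - r <= r by lra.
have up := mollified_expanding n _ _ r0.
have rN0 : - r <= 0 by rewrite oppr_le0.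
have lo := mollified_expanding n _ _ rN0.
move: up lo; rewrite mollified0 subr0 sub0r opprK sr sub0r => up lo.
have [||x _ <-] := @IVT _ (mollified n) (- r) r t rr.
- exact/continuous_subspaceT/mollified_continuous.
- rewrite ge_min le_max; have := ler_norm t; have := ler_norm (- t).
  by rewrite normrN => t1 t2; apply/andP; split; apply/orP; [left|right]; lra.
by exists x.
Qed.

(** By the mean value theorem the average over [[y, y + 1/n]] is a value of [E] there, squeezed
    between [E y] and [E (y + 1/n)]. The shift tends to [E 0 = 0]. *)
Lemma mollified_cvg x : mollified n x @[n --> \oo] --> E x.
Proof.
have inv0 : n%:R^-1 @[n --> \oo] --> (0 : R).
  apply/cvgr0Pnorm_le => e e0; near=> n.
  have n0 : (0 < n)%N by near: n; exact: nbhs_infty_gt.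
  rewrite ger0_norm ?invr_ge0// -[e]invrK lef_pV2 ?posrE ?invr_gt0 ?ltr0n//.
  near: n; exact: nbhs_infty_ger.
have avg y : n%:R * (F (y + n%:R^-1) - F y) @[n --> \oo] --> E y.
  have Ey : E (y + n%:R^-1) @[n --> \oo] --> E y.
    apply: (cvg_comp (fun n : nat => y + n%:R^-1) E); last exact: E_cont.
    by rewrite -{2}[y]addr0; apply: cvgD => //; exact: cvg_cst.
  apply: (@squeeze_cvgr _ _ _ _ (cst (E y)) _ _ _ _ _ Ey); last exact: cvg_cst.
  near=> n; have n0 : (0 < n)%N by near: n; exact: nbhs_infty_gt.
  have yn : y <= y + n%:R^-1 by rewrite lerDl invr_ge0.
  have cF : {within `[y, y + n%:R^-1], continuous F}.
    apply: continuous_subspaceT => z.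
    by apply: differentiable_continuous; apply/derivable1_diffP; case: (dF z).
  have [c] := MVT_segment yn (fun z _ => dF z) cF.
  rewrite in_itv/= => /andP[yc cy] ->.
  rewrite [y + _ - y]addrAC subrr add0r mulrCA divff ?mulr1 ?pnatr_eq0 -?lt0n//.
  by rewrite /= !E_homo.
rewrite -[E x]subr0 -[X in _ - X]E0 -[X in _ --> X]addr0.
apply: cvgD; first by apply: cvgB; exact: avg.
rewrite -[X in _ --> X](mul0r x).
by apply: cvgMr_tmp; exact: slope_cvg0.
Unshelve. all: by end_near. Qed.

(** The rate is at least [n^(-1/2)], so its product with [n] is at least [n^(1/2)]. *)
Lemma mollified_correction n x : (0 < n)%N ->
  0 <= (n%:R * mollified_rate n x)^-1 <= Num.sqrt n%:R^-1.
Proof.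
move=> n0; have s0 := slope_gt0 _ n0.
have nR : 0 < n%:R :> R by rewrite ltr0n.
have d0 := mollified_rate_gt0 n x n0.
rewrite invr_ge0 mulr_ge0 ?(ltW d0)//=.
rewrite -[leRHS]invrK lef_pV2 ?posrE ?invr_gt0 ?mulr_gt0//.
have -> : (Num.sqrt n%:R^-1)^-1 = n%:R * Num.sqrt (n%:R^-1 : R).
  apply: (mulIf (lt0r_neq0 s0)).
  by rewrite mulVf ?gt_eqF// -mulrA -expr2 sqr_sqrtr ?invr_ge0// divff ?gt_eqF.
by rewrite ler_pM2l// mollified_rate_ge.
Qed.

Lemma mollified_field_classG n : (0 < n)%N -> classG (mollified_field n).
Proof.
move=> n0; have s0 := slope_gt0 _ n0; split.
- apply: continuous_subspaceT => -[t x]; rewrite /mollified_field.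
  apply: cvgD.
    apply: cvgB; first exact: cvg_fst.
    apply: (cvg_comp (@snd R R) (mollified n)); first exact: cvg_snd.
    exact: mollified_continuous.
  apply: cvgV => /=.
    by rewrite mulf_neq0 ?pnatr_eq0 -?lt0n// gt_eqF// mollified_rate_gt0.
  apply: cvgMl_tmp; apply: (cvg_comp (@snd R R) (mollified_rate n)).
    exact: cvg_snd.
  apply: cvgD; last exact: cvg_cst.
  apply: cvgMl_tmp; apply: cvgB; last exact: E_cont.
  apply: (cvg_comp (fun z => z + n%:R^-1) E); last exact: E_cont.
  by apply: cvgD; [exact: cvg_id|exact: cvg_cst].
- rewrite /mollified_field mollified0 subrr add0r.
  by case/andP: (mollified_correction n 0 n0).
- by move=> x _ s t _ _ st; rewrite /mollified_field !ltrD2r.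
- move=> t; rewrite /Rplus/= in_itv/= andbT => t0.
  pose s := Num.sqrt (n%:R^-1 : R).
  (* Here [mollified n x] is at least [t + s + 1] and the correction at most [s], so the field is at
     most -1. *)
  pose x := (t + s + 1) / s.
  have x0 : 0 <= x by rewrite divr_ge0// ?ltW// /s; lra.
  have sx : s * x = t + s + 1 by rewrite mulrC divfK ?gt_eqF.
  apply: (@le_lt_trans _ _ (mollified_field n t x)%:E).
    by apply: ereal_inf_lbound; exists x; rewrite // /Rplus/= in_itv/= x0.
  rewrite lte_fin /mollified_field.
  have := mollified_expanding n _ _ x0.
  rewrite mollified0 !subr0 -/s sx.
  by have /andP[_] := mollified_correction n x n0; rewrite -/s; lra.
- move=> x; rewrite /Rplus/= in_itv/= andbT => x0.
  have /andP[c0 _] := mollified_correction n x n0.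
  have := mollified_expanding n _ _ x0; rewrite mollified0 !subr0 => m0.
  have {}m0 : 0 <= mollified n x by rewrite (le_trans _ m0)// mulr_ge0// ltW.
  (* One time unit after [mollified n x] the lag is 1 and the correction is nonnegative. *)
  apply: (@lt_le_trans _ _ (mollified_field n (mollified n x + 1) x)%:E).
    by rewrite lte_fin /mollified_field; lra.
  apply: ereal_sup_ubound; exists (mollified n x + 1) => //.
  by rewrite /Rplus/= in_itv/= andbT; lra.
Qed.

(** The time variable cancels: the error is [mollified n x - E x] minus the correction, and each
    part is eventually at most [e / 2]. *)
Lemma mollified_field_cvg :
  norm_Rplus2 (fun t x => t - E x - mollified_field n t x) @[n --> \oo]
    --> (0 : R).
Proof.
apply: norm_Rplus2_cvg0 => K e e0.
have e2 : 0 < e / 2 by rewrite divr_gt0.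
have hom n : (0 < n)%N -> {homo mollified n : x y / x <= y}.
  by move=> n0; apply: ltW_homo; exact: mollified_lt.
have hu := homo_cvg_unif _ _ 0 K%:R hom E_cont mollified_cvg _ e2.
have /cvgr0Pnorm_le/(_ _ e2) hs := slope_cvg0.
apply: filterS (filterI (nbhs_infty_gt 0) (filterI hu hs)).
move=> n [/= n0 [hun hsn]] t x _ xK; rewrite /mollified_field.
have /andP[c0 c1] := mollified_correction n x n0.
move: (hun x xK) hsn; rewrite [`|Num.sqrt _|]ger0_norm ?sqrtr_ge0// !ler_norml.
by move=> /andP[? ?] ?; apply/andP; split; lra.
Qed.

Lemma mollified_solution :
  exists phi_ : nat -> R -> R, forall n, (0 < n)%N ->
    global_solution (fun t x => n%:R * mollified_field n t x) (phi_ n).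
Proof.
have /choice[phi_ hphi] n : exists phi : R -> R, (0 < n)%N ->
    forall t, mollified n (phi t) = t.
  (* For [n = 0] nothing is required and [id] is a placeholder. *)
  have [n0|] := boolP (0 < n)%N; last by exists id.
  by have /choice[phi hphi] := fun t => mollified_surj n t n0; exists phi.
exists phi_ => n n0; apply: inverse_global_solution.
- by rewrite ltr0n.
- exact: mollified0.
- exact: mollified_lt.
- exact: is_derive_mollified.
- by move=> x; exact: mollified_rate_gt0.
- exact: hphi.
Qed.

End SmoothApproximation.

Theorem mainTheorem9 (R : realType) :
  (* convergence of the solutions *)
  (forall phibar theta w : R -> R,
     Phibar phibar -> classTheta theta -> classW w ->
     (forall x, 0 <= x -> run_max w x = theta (exit_time phibar x)) ->
     let g0 := fun t x => theta t - w x in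
     classG g0 /\
     forall g_ : nat -> R -> R -> R,
       (forall n, (0 < n)%N -> classG (g_ n)) ->
       norm_Rplus2 (fun t x => g0 t x - g_ n t x) @[n --> \oo] --> (0 : R) ->
       forall phi_ : nat -> R -> R,
         (forall n, (0 < n)%N ->
            global_solution (fun t x => n%:R * g_ n t x) (phi_ n)) ->
         cvg_Phibar phi_ phibar) /\
  (* the examples w := theta \o E(phibar) and g_n := g_0 *)
  (forall phibar theta : R -> R,
     Phibar phibar -> classTheta theta ->
     let w := fun x => theta (exit_time phibar x) in
     let g0 := fun t x => theta t - w x in
     [/\ classW w,
         forall x, 0 <= x -> run_max w x = theta (exit_time phibar x),
         classG g0
       & norm_Rplus2 (fun t x => g0 t x - g0 t x) @[n --> \oo] --> (0 : R)]) /\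
  (* every element of Phibar is a limit of such solutions *)
  (forall phibar : R -> R, Phibar phibar ->
     exists (theta w : R -> R) (g_ : nat -> R -> R -> R) (phi_ : nat -> R -> R),
       [/\ classTheta theta /\ classW w,
           forall x, 0 <= x -> run_max w x = theta (exit_time phibar x),
           forall n, (0 < n)%N -> classG (g_ n),
           norm_Rplus2 (fun t x => theta t - w x - g_ n t x) @[n --> \oo]
             --> (0 : R)
         & (forall n, (0 < n)%N ->
              global_solution (fun t x => n%:R * g_ n t x) (phi_ n)) /\
           cvg_Phibar phi_ phibar]).
Proof.
split; [|split].
- move=> phibar theta w Pphi Tth Ww hM g0; split; first exact: classG_sub.
  by move=> g_ Gg cg phi_ sol; apply: (solutions_cvg_Phibar _ theta w g_).
- move=> phibar theta Pphi Tth w g0.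
  have Ww := classW_exit_time _ _ Pphi Tth.
  split => //; [exact: run_max_exit_time|exact: classG_sub|].
  apply: norm_Rplus2_cvg0 => K eps eps0; near=> n => t x _ _.
  by rewrite subrr normr0 ltW.
- move=> phibar Pphi.
  (* With [theta] the identity, [w] is the exit time itself and the limit field is
     [t - exit_time phibar x]. *)
  have Tid : classTheta (fun t : R => t).
    by split=> //; apply: continuous_subspaceT => x; exact: cvg_id.
  have Ww := classW_exit_time _ _ Pphi Tid.
  have hM := run_max_exit_time _ _ Pphi Tid.
  have E_homo := exit_time_homo _ Pphi.
  have E_cont := exit_time_continuous _ Pphi.
  have E0 : exit_time phibar 0 = 0 by rewrite exit_time_le0.
  have [F dF] := continuous_primitive _ E_cont
    (fun x x0 => exit_time_le0 _ x Pphi x0).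
  have [phi_ sol] := mollified_solution _ _ E_homo dF.
  have Gg := mollified_field_classG _ _ E_homo E_cont dF.
  have cg := mollified_field_cvg _ _ E_homo E_cont E0 dF.
  exists id, (exit_time phibar), (mollified_field (exit_time phibar) F), phi_.
  split=> //; split=> //.
  exact: solutions_cvg_Phibar Pphi Tid Ww hM Gg cg sol.
Unshelve. all: by end_near. Qed.
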